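(* Let $n\ge1$ be an integer, let $B_0\subset\mathbb{R}^2$ be a box, let $f\colon\mathbb{R}^2\to\mathbb{R}$ be a function all of whose partial derivatives up to order $4n+4$ exist and are bounded on $B_0$, and for all integers $i,j\ge0$ with $i+j\in\{n,n+1\}$ let $\Box f^{(4i,4j)}$ be a range function for $f^{(4i,4j)}$ that is bounded over $B_0$. Then the recursive Hermite form $\Box^{\mathrm{H}}_{4,n}f$ of order $4$ and level $n$ (defined in the context) has quartic convergence on $B_0$; that is, there exists a constant $C>0$, which may depend on $f$ and $B_0$ (as well as on $n$ and the given range functions) but not on $B$, such that $$d_{\mathrm{H}}\bigl(f(B),\,\Box^{\mathrm{H}}_{4,n}f(B)\bigr)\le C\,w(B)^4$$ for all squares $B\subseteq B_0$ of positive radius.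
   Context: A box is a closed axis-aligned rectangle $B=[a_x,b_x]\times[a_y,b_y]\subset\mathbb{R}^2$; its midpoint is $\boldsymbol m=(m_x,m_y)=(a_x+b_x,a_y+b_y)/2$, its radii are $(r_x,r_y)=(b_x-a_x,b_y-a_y)/2$, and its width is $w(B)=2\max(r_x,r_y)$. A square is a box with $r_x=r_y$, and this common value is called its radius $r$. For a closed interval $I=[a,b]$, its magnitude is $|I|=\max\{|a|,|b|\}$. Intervals are added and scaled by interval arithmetic: $[a,b]+[c,d]=[a+c,b+d]$, and $[-1,1]\rho=[-\rho,\rho]$ for $\rho\ge 0$. The Hausdorff distance is $d_{\mathrm{H}}([a,b],[a',b'])=\max\{|a-a'|,|b-b'|\}$. For a function $g$ and a set $S$, $g(S)=\{g(x):x\in S\}$ is the exact range. A range function for $g\colon\mathbb{R}^2\to\mathbb{R}$ is a map $\Box g$ from boxes to closed bounded intervals with $\Box g(B)\supseteq g(B)$ for every box $B$ on which $g$ is defined (in particular for all $B\subseteq B_0$). It is bounded over $B_0$ if there is a constant $K$ with $|\Box g(B)|\le K$ for all boxes $B\subseteq B_0$. Partial derivatives are denoted by $f^{(i,j)}=\frac{\partial^{i+j}}{\partial x^i\partial y^j}f$. For $0\le k\le n$ define the (Delannoy) coefficients $$\begin{bmatrix}n\\ k\end{bmatrix}=\sum_{i=0}^k\binom ki\binom{n-k}i2^i.$$ Let $B$ be a square with midpoint $\boldsymbol m$ and radius $r>0$, and let $\Omega_{\mathrm H}=\frac1{24}r^4$. For $i,j\ge0$ let $H_{i,j}$ be the unique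 bicubic polynomial (degree at most $3$ in $x$ and at most $3$ in $y$) that interpolates $f^{(4i,4j)}$, $f^{(4i+1,4j)}$, $f^{(4i,4j+1)}$ and $f^{(4i+1,4j+1)}$ at the four corners of $B$, i.e. at each corner the values of $H_{i,j}$, $H_{i,j}^{(1,0)}$, $H_{i,j}^{(0,1)}$, $H_{i,j}^{(1,1)}$ agree with those of $f^{(4i,4j)}$, $f^{(4i+1,4j)}$, $f^{(4i,4j+1)}$, $f^{(4i+1,4j+1)}$, respectively. Split $H_{i,j}=T^{\mathrm H}_{i,j}+R^{\mathrm H}_{i,j}$, where $T^{\mathrm H}_{i,j}$ is the Taylor polynomial of $H_{i,j}$ of (total) degree $3$ about $\boldsymbol m$ and $R^{\mathrm H}_{i,j}=H_{i,j}-T^{\mathrm H}_{i,j}$ is the remainder. The recursive Hermite form of order $4$ and level $n$ is $$\Box^{\mathrm H}_{4,n}f(B)=T^{\mathrm H}_{0,0}(B)+R^{\mathrm H}_{0,0}(B)+[-1,1]\,V_{4,n},\qquad V_{4,n}=\sum_{k=1}^{n+1}v_k\,\Omega_{\mathrm H}^k,$$ where $$v_k=\sum_{j=0}^k\begin{bmatrix}k\\ j\end{bmatrix}\bigl|T^{\mathrm H}_{k-j,j}(B)+R^{\mathrm H}_{k-j,j}(B)\bigr|\quad(k=1,\dots,n-1),$$ $$v_n=\sum_{j=0}^n\begin{bmatrix}n\\ j\end{bmatrix}\bigl|\Box f^{(4(n-j),4j)}(B)\bigr|,\qquad v_{n+1}=\sum_{j=1}^n\begin{bmatrix}n-1\\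 j-1\end{bmatrix}\bigl|\Box f^{(4(n+1-j),4j)}(B)\bigr|.$$ Here $T^{\mathrm H}_{i,j}(B)$ and $R^{\mathrm H}_{i,j}(B)$ are exact ranges and sums of them are interval sums. *)

(* Defs.v *)
From HB Require Import structures.
From mathcomp Require Import all_boot all_order all_algebra.
From mathcomp Require Import all_classical all_reals all_analysis.

Set Implicit Arguments.
Unset Strict Implicit.
Unset Printing Implicit Defensive.

Import Order.TTheory GRing.Theory Num.Theory.
Import numFieldNormedType.Exports.

Local Open Scope classical_set_scope.
Local Open Scope ring_scope.

(* Degenerate boxes are allowed; the plane is R * R. *)
Record box (R : realType) := Box {
  xlo : R; xhi : R; ylo : R; yhi : R;
  box_x : xlo <= xhi;
  box_y : ylo <= yhi }.

Definition box_set (R : realType) (B : box R) : set (R * R) :=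
  `[xlo B, xhi B] `*` `[ylo B, yhi B].

Definition box_midpoint (R : realType) (B : box R) : R * R :=
  ((xlo B + xhi B) / 2, (ylo B + yhi B) / 2).

Definition box_rx (R : realType) (B : box R) : R := (xhi B - xlo B) / 2.
Definition box_ry (R : realType) (B : box R) : R := (yhi B - ylo B) / 2.

Definition box_width (R : realType) (B : box R) : R :=
  2 * Num.max (box_rx B) (box_ry B).

Definition is_square (R : realType) (B : box R) : Prop :=
  box_rx B = box_ry B.

(* Meaningful for squares only, where both radii agree. *)
Definition box_radius (R : realType) (B : box R) : R := box_rx B.

Definition is_corner (R : realType) (B : box R) (p : R * R) : Prop :=
  (p.1 = xlo B \/ p.1 = xhi B) /\ (p.2 = ylo B \/ p.2 = yhi B).

Record itv2 (R : realType) := Itv2 { ilo : R; ihi : R }.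

Definition itv2_set (R : realType) (I : itv2 R) : set R := `[ilo I, ihi I].

Definition itv_add (R : realType) (I J : itv2 R) : itv2 R :=
  Itv2 (ilo I + ilo J) (ihi I + ihi J).

Definition itv_sym (R : realType) (rho : R) : itv2 R := Itv2 (- rho) rho.

Definition itv_mag (R : realType) (I : itv2 R) : R :=
  Num.max `|ilo I| `|ihi I|.

Definition itv_hausdorff (R : realType) (I J : itv2 R) : R :=
  Num.max `|ilo I - ilo J| `|ihi I - ihi J|.

(* The exact range g(B), given by its endpoints: for g continuous on the
   compact connected set B, the image g @` B is exactly the closed interval
   [inf (g @` box_set B), sup (g @` box_set B)]. *)
Definition range_on (R : realType) (g : R * R -> R) (B : box R) : itv2 R :=
  Itv2 (inf (g @` box_set B)) (sup (g @` box_set B)).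

(* f^(i,j): differentiate j times in y, then i times in x.  It is a total
   function, with unspecified values where the derivative does not exist. *)
Definition partial (R : realType) (f : R * R -> R) (i j : nat) (p : R * R) :
    R :=
  derive1n i (fun s : R => derive1n j (fun t : R => f (s, t)) p.2) p.1.

(* The k-th derivative of g exists at t.  The lower ones are required near t, so
   that no unspecified value enters the last difference quotient. *)
Fixpoint ex_derivn (R : realType) (g : R -> R) (k : nat) (t : R) : Prop :=
  match k with
  | 0 => True
  | k'.+1 => (\forall u \near t, ex_derivn g k' u) /\
             derivable (derive1n k' g) t 1
  end.

Fixpoint ex_partial (R : realType) (f : R * R -> R) (i j : nat) (p : R * R) :
    Prop :=
  match i with
  | 0 => ex_derivn (fun t : R => f (p.1, t)) j p.2
  | i'.+1 => (\forall s \near p.1, ex_partial f i' j (s, p.2)) /\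
             derivable (fun s : R => partial f i' j (s, p.2)) p.1 1
  end.

Definition bounded_partials_upto (R : realType) (f : R * R -> R) (N : nat)
    (B0 : box R) : Prop :=
  forall i j : nat, (i + j <= N)%N ->
    (forall p, box_set B0 p -> ex_partial f i j p) /\
    (exists M : R, forall p, box_set B0 p -> `|partial f i j p| <= M).

(* G is a range function for g, where g is defined on the set D only. *)
Definition is_range_function (R : realType) (D : set (R * R)) (g : R * R -> R)
    (G : box R -> itv2 R) : Prop :=
  forall B : box R, box_set B `<=` D -> g @` box_set B `<=` itv2_set (G B).

Definition range_function_bounded (R : realType) (B0 : box R)
    (G : box R -> itv2 R) : Prop :=
  exists K : R, forall B : box R, box_set B `<=` box_set B0 ->
    itv_mag (G B) <= K.

Definition delannoy (n k : nat) : nat :=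
  (\sum_(0 <= i < k.+1) 'C(k, i) * 'C(n - k, i) * 2 ^ i)%N.

Definition poly_fun (R : realType) (P : {poly {poly R}}) (p : R * R) : R :=
  P.[p.1, p.2].

Definition bicubic (R : realType) (P : {poly {poly R}}) : Prop :=
  (size P <= 4)%N /\ (sizeY P <= 4)%N.

Definition hermite_interpolates (R : realType) (f : R * R -> R) (B : box R)
    (i j : nat) (h : R * R -> R) : Prop :=
  forall p, is_corner B p ->
    [/\ h p = partial f (4 * i) (4 * j) p,
        partial h 1 0 p = partial f (4 * i + 1) (4 * j) p,
        partial h 0 1 p = partial f (4 * i) (4 * j + 1) p &
        partial h 1 1 p = partial f (4 * i + 1) (4 * j + 1) p].

(* H_{i,j}.  When both radii of B are positive the interpolant exists and is
   unique, so the default value 0 is never used. *)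
Definition hermite_poly (R : realType) (f : R * R -> R) (B : box R)
    (i j : nat) : {poly {poly R}} :=
  xget 0 [set P : {poly {poly R}} |
            bicubic P /\ hermite_interpolates f B i j (poly_fun P)].

Definition hermite (R : realType) (f : R * R -> R) (B : box R) (i j : nat) :
    R * R -> R :=
  poly_fun (hermite_poly f B i j).

Definition taylor (R : realType) (d : nat) (g : R * R -> R) (m p : R * R) : R :=
  \sum_(0 <= a < d.+1) \sum_(0 <= b < d.+1 | (a + b <= d)%N)
    partial g a b m / (a`! * b`!)%:R * (p.1 - m.1) ^+ a * (p.2 - m.2) ^+ b.

Definition hermite_T (R : realType) (f : R * R -> R) (B : box R) (i j : nat) :
    R * R -> R :=
  taylor 3 (hermite f B i j) (box_midpoint B).

Definition hermite_R (R : realType) (f : R * R -> R) (B : box R) (i j : nat)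
    (p : R * R) : R :=
  hermite f B i j p - hermite_T f B i j p.

Definition hermite_TR (R : realType) (f : R * R -> R) (B : box R) (i j : nat) :
    itv2 R :=
  itv_add (range_on (hermite_T f B i j) B) (range_on (hermite_R f B i j) B).

Definition Omega_H (R : realType) (B : box R) : R := 24^-1 * box_radius B ^+ 4.

(* v_k for 1 <= k <= n + 1, where F i j is the range function of f^(4i,4j). *)
Definition hermite_v (R : realType) (f : R * R -> R)
    (F : nat -> nat -> box R -> itv2 R) (n : nat) (B : box R) (k : nat) : R :=
  if (k < n)%N then
    \sum_(0 <= j < k.+1)
      (delannoy k j)%:R * itv_mag (hermite_TR f B (k - j) j)
  else if k == n then
    \sum_(0 <= j < n.+1) (delannoy n j)%:R * itv_mag (F (n - j)%N j B)
  else
    \sum_(1 <= j < n.+1)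
      (delannoy n.-1 j.-1)%:R * itv_mag (F (n.+1 - j)%N j B).

Definition hermite_V (R : realType) (f : R * R -> R)
    (F : nat -> nat -> box R -> itv2 R) (n : nat) (B : box R) : R :=
  \sum_(1 <= k < n.+2) hermite_v f F n B k * Omega_H B ^+ k.

Definition hermite_form (R : realType) (f : R * R -> R)
    (F : nat -> nat -> box R -> itv2 R) (n : nat) (B : box R) : itv2 R :=
  itv_add (hermite_TR f B 0 0) (itv_sym (hermite_V f F n B)).

(* Main.v *)
Require Import Defs.
From HB Require Import structures.
From mathcomp Require Import all_boot all_order all_algebra.
From mathcomp Require Import all_classical all_reals all_analysis.
From mathcomp Require Import ring lra zify.

Set Implicit Arguments.
Unset Strict Implicit.
Unset Printing Implicit Defensive.

Import Order.TTheory GRing.Theory Num.Theory.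
Import numFieldNormedType.Exports.

Local Open Scope classical_set_scope.
Local Open Scope ring_scope.

(** Fix a square [B] of midpoint [m] and radius [r].  Every term of the
    recursive form besides [T_00(B) + R_00(B)] carries a factor
    [Omega_H = r^4 / 24], so the theorem reduces to two facts.

    The numbers [v_k] are bounded uniformly in [B].  For [k = n] and
    [k = n + 1] this is the boundedness of the given range functions.  For
    [k < n] it holds because Hermite interpolation becomes one fixed linear
    map in the variables [(p - m) / r]: if the datum of order [(e, l)] is
    multiplied by [r^(e + l)], the coefficient of index [(a, b)] times
    [r^(a + b)] is at most [4] times the largest datum (lemma [hermite2_le]),
    and here the data are partial derivatives of [f] of order at most
    [4 n - 2].

    On [B] one has [f - T_00 = O(r^4)] and [R_00 = O(r^4)] (lemma
    [hermite_approx]).  Let [S] be the Taylor polynomial of [f] about [m] of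
    degree [3] in each variable.  By [partial_taylor2] the difference [f - S]
    is [O(r^4)] on [B], and so are its Hermite data at the corners once they
    are scaled.  As [H_00 - S] is the bicubic polynomial with those data, its
    scaled coefficients are [O(r^4)] by [hermite2_le].  The scaled
    coefficients of [S] of total degree at least [4] are [O(r^4)] as well,
    hence [R_00 = O(r^4)], and
    [f - T_00 = (f - S) - (H_00 - S) + R_00] is [O(r^4)].  Finally, the
    endpoints of an exact range move by no more than the function does in the
    supremum norm ([range_on_dist]).

    One point needs care in the Taylor estimate.  The derivative [f^(i,j)] is
    taken [j] times in [y] first and then [i] times in [x], and nothing is
    known about derivatives in another order.  Expanding [f^(0,l)] in [y] and
    the coefficients [f^(0,b)(., m_y)] in [x] respects this order, but
    interpolation also involves [f^(1,0)] and [f^(1,1)], whose derivatives in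
    [y] need not exist.  They nevertheless have the expected expansion in [y]:
    the remainder of [f^(0,l)] is a Lipschitz function of [x], by a mixed
    difference bounded through [f^(1,k)], and the remainder of [f^(1,l)] is
    its derivative ([partial_taylory1]). *)

(** * Taylor estimates in one variable *)

(** The [e]-th derivative at [u] of the polynomial with coefficients
    [c 0, ..., c d.-1].  The falling factorial kills the terms of degree below
    [e], so one formula serves for all orders, including those beyond the
    degree. *)
Definition dpoly (R : realType) (d : nat) (c : nat -> R) (e : nat) (u : R) :
    R :=
  \sum_(a < d) c a * (a ^_ e)%:R * u ^+ (a - e).

Lemma is_derive_dpoly (R : realType) (d : nat) (c : nat -> R) (e : nat)
    (m s : R) :
  is_derive s 1 (fun t => dpoly d c e (t - m)) (dpoly d c e.+1 (s - m)).
Proof.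
rewrite /dpoly.
have -> : (fun t : R => \sum_(a < d) c a * (a ^_ e)%:R * (t - m) ^+ (a - e)) =
    \sum_(a < d) (fun t : R => c a * (a ^_ e)%:R * (t - m) ^+ (a - e)).
  by apply/funext => t; rewrite fct_sumE.
apply: is_derive_sum => a.
have D1 : is_derive s 1 (fun t : R => (t - m) ^+ (a - e))
    ((a - e)%:R * (s - m) ^+ (a - e).-1).
  have D0 : is_derive s 1 (fun t : R => t - m) 1.
    by apply: is_derive_eq; rewrite subr0.
  have -> : (fun t : R => (t - m) ^+ (a - e)) = (fun t : R => t - m) ^+ (a - e).
    by apply/funext => t; rewrite exprfctE.
  apply: (is_derive_eq (is_deriveX (a - e) D0)).
  by rewrite [_ *: 1]mulr1.
apply: (is_derive_eq (is_deriveZ (c a * (a ^_ e)%:R) D1)).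
by rewrite ffactnSr natrM subnS scalerAl mulrA -[RHS]mulrA /GRing.scale /= !mulrA.
Qed.

Lemma derive1n_dpoly (R : realType) (d : nat) (c : nat -> R) (e : nat) (m : R) :
  derive1n e (fun t => dpoly d c 0 (t - m)) = fun t => dpoly d c e (t - m).
Proof.
elim: e => [|e IH]; first by rewrite derive1n0.
rewrite derive1nS IH; apply/funext => t; rewrite derive1E.
by have := is_derive_dpoly d c e m t => -[].
Qed.

Lemma dpoly_at0 (R : realType) (d : nat) (c : nat -> R) (e : nat) :
  (e < d)%N -> dpoly d c e 0 = c e * (e`!)%:R.
Proof.
move=> ed; rewrite /dpoly (bigD1 (Ordinal ed)) //= subnn expr0 mulr1 ffactnn.
rewrite big1 ?addr0 // => a; rewrite -val_eqE /= => ae.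
have [lt_ae|] := ltnP a e; first by rewrite ffact_small // mulr0 mul0r.
by rewrite leq_eqVlt eq_sym (negbTE ae) /= -subn_gt0 => h;
  rewrite expr0n gtn_eqF // mulr0.
Qed.

Lemma dpoly_over (R : realType) (d : nat) (c : nat -> R) (e : nat) (u : R) :
  (d <= e)%N -> dpoly d c e u = 0.
Proof.
move=> de; rewrite /dpoly big1 // => a _.
by rewrite ffact_small ?mulr0 ?mul0r // (leq_trans _ de).
Qed.

(** The derivative has to be bounded only at points no farther from [c] than
    [x] is; in [taylor_le] the available bound grows with that distance. *)
Lemma mvt_le (R : realType) (lo hi c x K : R) (F F' : R -> R) :
  lo <= c <= hi -> lo <= x <= hi ->
  (forall t, lo <= t <= hi -> is_derive t 1 F (F' t)) ->
  (forall t, lo <= t <= hi -> `|t - c| <= `|x - c| -> `|F' t| <= K) ->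
  `|F x - F c| <= K * `|x - c|.
Proof.
move=> hc hx dF bF.
have cont a b : lo <= a -> b <= hi -> {within `[a, b], continuous F}.
  move=> la bh; apply: derivable_within_continuous => t; rewrite in_itv /= => ht.
  by have [] := dF t ltac:(lra).
have [cx|xc] := leP c x.
  have [||t tcx ->] := @MVT_segment R F F' c x cx.
  - by move=> t; rewrite in_itv /= => ht; apply: dF; lra.
  - by apply: cont; lra.
  rewrite normrM ler_wpM2r // bF //; move: tcx; rewrite in_itv /= => ht;
    first lra.
  by rewrite !ger0_norm; lra.
have [||t tcx E] := @MVT_segment R F F' x c (ltW xc).
- by move=> t; rewrite in_itv /= => ht; apply: dF; lra.
- by apply: cont; lra.
rewrite distrC E normrM [X in _ <= K * X]distrC ler_wpM2r // bF //;
  move: tcx; rewrite in_itv /= => ht;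
    first lra.
by rewrite distrC [leRHS]distrC !ger0_norm; lra.
Qed.

(** The error [G l x - dpoly ... l (x - c)] of level [l] vanishes at [x = c] and
    its derivative is the error of level [l + 1].  Starting from level [k],
    where the polynomial part is zero, each step down costs one application of
    the mean value inequality and gains one factor [|x - c|].  A sequence [G]
    in which each function is the derivative of the previous one, rather than
    the iterated derivatives of one function, covers increments of partial
    derivatives as well. *)
Lemma taylor_le (R : realType) (lo hi c x M : R) (G : nat -> R -> R)
    (k l : nat) :
  (l <= k)%N -> lo <= c <= hi -> lo <= x <= hi ->
  (forall j t, (j < k)%N -> lo <= t <= hi -> is_derive t 1 (G j) (G j.+1 t)) ->
  (forall t, lo <= t <= hi -> `|G k t| <= M) ->
  `|G l x - dpoly k (fun b => G b c / (b`!)%:R) l (x - c)| <=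
    M * `|x - c| ^+ (k - l).
Proof.
move=> lk hc + dG bG.
have M0 : 0 <= M by apply: le_trans (bG c hc).
rewrite -[X in G X](subKn lk) -[X in dpoly _ _ X](subKn lk).
elim: (k - l)%N (leq_subr l k) x => [_|d IH dk] x hx.
  by rewrite subn0 dpoly_over // subr0 expr0 mulr1 bG.
have dk' : (k - d.+1 < k)%N by rewrite ltn_subrL /= (leq_trans _ dk).
set e := (k - d.+1)%N in dk' *.
have eS : e.+1 = (k - d)%N by rewrite /e subnSK.
pose cc := fun b => G b c / (b`!)%:R.
pose E := fun t => G e t - dpoly k cc e (t - c).
have Ec : E c = 0.
  by rewrite /E subrr dpoly_at0 // /cc divfK ?subrr // pnatr_eq0 -lt0n fact_gt0.
have := @mvt_le R lo hi c x (M * `|x - c| ^+ d) E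
  (fun t => G e.+1 t - dpoly k cc e.+1 (t - c)) hc hx.
rewrite Ec subr0 exprSr mulrA; apply => t ht.
  have h1 := dG e t dk' ht; have h2 := is_derive_dpoly k cc e c t.
  exact: is_deriveB.
move=> tx; rewrite eS; apply: (le_trans (IH (ltnW dk) t ht)).
by rewrite ler_wpM2l // lerXn2r ?nnegrE.
Qed.

(** The increments are controlled on one side of [x] at least, which is enough
    because the difference quotient has a two-sided limit; [x] may therefore be
    an endpoint. *)
Lemma derive_le_lipschitz (R : realType) (lo hi x K df : R) (F : R -> R) :
  lo < hi -> lo <= x <= hi -> is_derive x 1 F df ->
  (forall s, lo <= s <= hi -> `|F s - F x| <= K * `|s - x|) -> `|df| <= K.
Proof.
move=> lohi hx [dF <-] lip.
have C : (fun h : R => `|h^-1 *: (F (h *: 1 + x) - F x)|) h @[h --> 0^'] -->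
    `|'D_1 F x|.
  exact: (cvg_norm dF).
have bnd h : h != 0 -> lo <= h + x <= hi ->
    `|h^-1 *: (F (h *: 1 + x) - F x)| <= K.
  move=> h0 hh; rewrite [h *: 1]mulr1 normrZ normfV.
  by rewrite mulrC ler_pdivrMr ?normr_gt0 // (le_trans (lip _ hh)) // addrK.
have [xhi|] := ltP x hi.
  apply: (cvgr_to_le (cvg_dnbhs_at_right C)).
  near=> h; apply: bnd.
    by rewrite gt_eqF //; near: h; exact: nbhs_right_gt.
  have h1 : 0 < h by near: h; exact: nbhs_right_gt.
  have h2 : h < hi - x by near: h; apply: nbhs_right_lt; lra.
  by lra.
move=> xhi; apply: (cvgr_to_le (cvg_dnbhs_at_left C)).
near=> h; apply: bnd.
  by rewrite lt_eqF //; near: h; exact: nbhs_left_lt.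
have h1 : h < 0 by near: h; exact: nbhs_left_lt.
have h2 : lo - x < h by near: h; apply: nbhs_left_gt; lra.
by lra.
Unshelve. all: end_near. Qed.

Definition dpoly2 (R : realType) (d : nat) (c : nat -> nat -> R) (e l : nat)
    (u v : R) : R :=
  \sum_(a < d) \sum_(b < d)
    c a b * (a ^_ e)%:R * (b ^_ l)%:R * u ^+ (a - e) * v ^+ (b - l).

Lemma dpoly2_xy (R : realType) (d : nat) (c : nat -> nat -> R) (e l : nat)
    (u v : R) :
  dpoly2 d c e l u v = dpoly d (fun a => dpoly d (c a) l v) e u.
Proof.
apply: eq_bigr => a _; rewrite /dpoly !mulr_suml.
by apply: eq_bigr => b _; ring.
Qed.

Lemma dpoly2_yx (R : realType) (d : nat) (c : nat -> nat -> R) (e l : nat)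
    (u v : R) :
  dpoly2 d c e l u v = dpoly d (fun b => dpoly d (fun a => c a b) e u) l v.
Proof.
rewrite /dpoly2 exchange_big; apply: eq_bigr => b _; rewrite /dpoly !mulr_suml.
by apply: eq_bigr => a _; ring.
Qed.

Lemma dpolyB (R : realType) (d : nat) (c c' : nat -> R) (e : nat) (u : R) :
  dpoly d c e u - dpoly d c' e u = dpoly d (fun a => c a - c' a) e u.
Proof.
by rewrite /dpoly -sumrB; apply: eq_bigr => a _; rewrite !mulrBl.
Qed.

Lemma dpoly2B (R : realType) (d : nat) (c c' : nat -> nat -> R) (e l : nat)
    (u v : R) :
  dpoly2 d c e l u v - dpoly2 d c' e l u v =
  dpoly2 d (fun a b => c a b - c' a b) e l u v.
Proof.
rewrite /dpoly2 -sumrB; apply: eq_bigr => a _; rewrite -sumrB.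
by apply: eq_bigr => b _; ring.
Qed.

(** For polynomials the order of differentiation is immaterial; the summation is
    reordered to expose first the variable [y], then the variable [x]. *)
Lemma partial_dpoly2 (R : realType) (d : nat) (c : nat -> nat -> R) (e l : nat)
    (m p : R * R) :
  partial (fun q => dpoly2 d c 0 0 (q.1 - m.1) (q.2 - m.2)) e l p =
  dpoly2 d c e l (p.1 - m.1) (p.2 - m.2).
Proof.
rewrite /partial /=.
have -> : (fun s => derive1n l
    (fun t => dpoly2 d c 0 0 (s - m.1) (t - m.2)) p.2) =
    fun s => dpoly d (fun a => dpoly d (c a) l (p.2 - m.2)) 0 (s - m.1).
  apply/funext => s.
  have -> : (fun t => dpoly2 d c 0 0 (s - m.1) (t - m.2)) =
    fun t => dpoly d (fun b => dpoly d (fun a => c a b) 0 (s - m.1)) 0 (t - m.2).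
    by apply/funext => t; rewrite dpoly2_yx.
  by rewrite derive1n_dpoly -dpoly2_yx dpoly2_xy.
by rewrite derive1n_dpoly dpoly2_xy.
Qed.

Lemma is_derive_partialx (R : realType) (f : R * R -> R) (N : nat) (B0 : box R)
    (i j : nat) (s y : R) :
  bounded_partials_upto f N B0 -> (i + j < N)%N -> box_set B0 (s, y) ->
  is_derive s 1 (fun t => partial f i j (t, y)) (partial f i.+1 j (s, y)).
Proof.
move=> hf ijN hs; have [ex _] := hf i.+1 j ijN.
have [_ /= dv] := ex _ hs.
apply: (is_derive_eq (derivableP dv)).
by rewrite -derive1E /partial (derive1nS _ i).
Qed.

Lemma is_derive_partialy (R : realType) (f : R * R -> R) (N : nat) (B0 : box R)
    (j : nat) (x t : R) :
  bounded_partials_upto f N B0 -> (j < N)%N -> box_set B0 (x, t) ->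
  is_derive t 1 (fun y => partial f 0 j (x, y)) (partial f 0 j.+1 (x, t)).
Proof.
move=> hf jN ht; have [ex _] := hf 0%N j.+1 jN.
have [_ /= dv] := ex _ ht.
apply: (is_derive_eq (derivableP dv)).
by rewrite -derive1E /partial !derive1n0 (derive1nS _ j).
Qed.

Lemma partials_common_bound (R : realType) (f : R * R -> R) (N : nat)
    (B0 : box R) :
  bounded_partials_upto f N B0 ->
  exists M : R, 0 <= M /\ forall i j p, (i + j <= N)%N -> box_set B0 p ->
    `|partial f i j p| <= M.
Proof.
move=> hf.
have /choice[m hm] (ij : nat * nat) : exists M : R, (ij.1 + ij.2 <= N)%N ->
    forall p, box_set B0 p -> `|partial f ij.1 ij.2 p| <= M.
  have [le|] := boolP (ij.1 + ij.2 <= N)%N; last by exists 0.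
  by have [_ [M hM]] := hf _ _ le; exists M.
exists (\sum_(i < N.+1) \sum_(j < N.+1) `|m (nat_of_ord i, nat_of_ord j)|); split.
  by apply: sumr_ge0 => i _; apply: sumr_ge0.
move=> i j p le hp; apply: (le_trans (hm (i, j) le p hp)).
have iN : (i < N.+1)%N by rewrite ltnS (leq_trans _ le) // leq_addr.
have jN : (j < N.+1)%N by rewrite ltnS (leq_trans _ le) // leq_addl.
rewrite (bigD1 (Ordinal iN)) //= (bigD1 (Ordinal jN)) //= -addrA.
apply: (le_trans (ler_norm _)); rewrite lerDl addr_ge0 //; apply: sumr_ge0 => // k _.
exact: sumr_ge0.
Qed.

(** * Taylor estimates in two variables *)
Section BoxTaylor.
Context (R : realType) (f : R * R -> R) (N : nat) (B0 : box R) (M : R).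
Hypothesis hf : bounded_partials_upto f N B0.
Hypothesis hM : forall i j p, (i + j <= N)%N -> box_set B0 p ->
  `|partial f i j p| <= M.

Lemma partial_taylorx (k e j : nat) (x c y : R) :
  (e <= k)%N -> (k + j <= N)%N -> box_set B0 (c, y) -> box_set B0 (x, y) ->
  `|partial f e j (x, y) -
    dpoly k (fun a => partial f a j (c, y) / (a`!)%:R) e (x - c)| <=
  M * `|x - c| ^+ (k - e).
Proof.
move=> ek kjN [/= hc hy] [/= hx _].
rewrite !in_itv /= in hc hx.
have in0 t : xlo B0 <= t <= xhi B0 -> box_set B0 (t, y).
  by split=> //=; rewrite in_itv.
apply: (taylor_le (G := fun a t => partial f a j (t, y)) ek hc hx).
  move=> i t ik ht; apply: (is_derive_partialx hf); last exact: in0.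
  by rewrite (leq_trans _ kjN) // ltn_add2r.
by move=> t ht; apply: hM => //; exact: in0.
Qed.

Lemma partial_taylory0 (k l : nat) (x c y : R) :
  (l <= k)%N -> (k <= N)%N -> box_set B0 (x, c) -> box_set B0 (x, y) ->
  `|partial f 0 l (x, y) -
    dpoly k (fun b => partial f 0 b (x, c) / (b`!)%:R) l (y - c)| <=
  M * `|y - c| ^+ (k - l).
Proof.
move=> lk kN [/= hx hc] [/= _ hy].
rewrite !in_itv /= in hc hy.
have in0 t : ylo B0 <= t <= yhi B0 -> box_set B0 (x, t).
  by split=> //=; rewrite in_itv.
apply: (taylor_le (G := fun b t => partial f 0 b (x, t)) lk hc hy).
  move=> i t ik ht; apply: (is_derive_partialy hf); last exact: in0.
  exact: leq_trans kN.
by move=> t ht; apply: hM => //; exact: in0.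
Qed.

(** Let [F s] be the remainder of order [k] of the expansion of
    [f^(0,l)(s, .)] about [c], taken at [y]; the quantity to bound is the
    derivative of [F] at [x].  The increment [F s - F x] is the remainder of
    the expansion of [t |-> f^(0,l)(s, t) - f^(0,l)(x, t)], whose derivative of
    order [k - l] is at most [M |s - x|] by the mean value inequality applied
    to [f^(0,k)] in the variable [x].  Thus [F] is Lipschitz with the constant
    claimed, and no derivative in [y] of [f^(1,l)] is taken. *)
Lemma partial_taylory1 (k l : nat) (x c y : R) :
  xlo B0 < xhi B0 ->
  (l <= k)%N -> (k < N)%N -> box_set B0 (x, c) -> box_set B0 (x, y) ->
  `|partial f 1 l (x, y) -
    dpoly k (fun b => partial f 1 b (x, c) / (b`!)%:R) l (y - c)| <=
  M * `|y - c| ^+ (k - l).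
Proof.
move=> lohi lk kN [/= hx hc] [/= _ hy].
rewrite !in_itv /= in hx hc hy.
have in0 s t : xlo B0 <= s <= xhi B0 -> ylo B0 <= t <= yhi B0 -> box_set B0 (s, t).
  by split=> /=; rewrite in_itv.
pose F s := partial f 0 l (s, y) -
  dpoly k (fun b => partial f 0 b (s, c) / (b`!)%:R) l (y - c).
apply: (derive_le_lipschitz (F := F) lohi hx).
  rewrite /F /dpoly; apply: is_deriveB.
    apply: (is_derive_partialx hf); last exact: in0.
    by rewrite add0n (leq_ltn_trans lk).
  have -> : (fun s => \sum_(a < k) partial f 0 a (s, c) / a`!%:R * (a ^_ l)%:R *
      (y - c) ^+ (a - l)) = \sum_(a < k) (fun s => partial f 0 a (s, c) / a`!%:R *
      (a ^_ l)%:R * (y - c) ^+ (a - l)).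
    by apply/funext => s; rewrite fct_sumE.
  apply: is_derive_sum => a.
  have D : is_derive x 1 (fun s => partial f 0 a (s, c)) (partial f 1 a (x, c)).
    apply: (is_derive_partialx hf); last exact: in0.
    by rewrite add0n (ltn_trans _ kN).
  pose w := (a`!%:R)^-1 * (a ^_ l)%:R * (y - c) ^+ (a - l).
  have -> : (fun s => partial f 0 a (s, c) / a`!%:R * (a ^_ l)%:R *
      (y - c) ^+ (a - l)) = w \*: (fun s => partial f 0 a (s, c)).
    apply/funext => s; transitivity (w * partial f 0 a (s, c)) => //.
    by rewrite /w; ring.
  apply: (is_derive_eq (is_deriveZ w D)).
  transitivity (w * partial f 1 a (x, c)) => //.
  by rewrite /w; ring.
move=> s hs.
pose G b t := partial f 0 b (s, t) - partial f 0 b (x, t).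
have -> : F s - F x = G l y - dpoly k (fun b => G b c / (b`!)%:R) l (y - c).
  have -> : dpoly k (fun b => G b c / (b`!)%:R) l (y - c) =
      dpoly k (fun b => partial f 0 b (s, c) / (b`!)%:R) l (y - c) -
      dpoly k (fun b => partial f 0 b (x, c) / (b`!)%:R) l (y - c).
    by rewrite dpolyB; apply: eq_bigr => b _; rewrite -mulrBl.
  by rewrite /F /G; ring.
rewrite mulrAC; apply: (taylor_le (G := G) lk hc hy).
  move=> b t bk ht; apply: is_deriveB; apply: (is_derive_partialy hf);
    by [exact: ltn_trans kN | exact: in0].
move=> t ht; apply: (mvt_le (F := fun s => partial f 0 k (s, t))
  (F' := fun s => partial f 1 k (s, t)) hx hs).
  by move=> s' hs'; apply: (is_derive_partialx hf) => //; exact: in0.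
by move=> s' hs' _; apply: hM => //; exact: in0.
Qed.

Lemma partial_taylory (e k l : nat) (x c y : R) :
  xlo B0 < xhi B0 ->
  (e < 2)%N -> (l <= k)%N -> (e + k <= N)%N -> box_set B0 (x, c) ->
  box_set B0 (x, y) ->
  `|partial f e l (x, y) -
    dpoly k (fun b => partial f e b (x, c) / (b`!)%:R) l (y - c)| <=
  M * `|y - c| ^+ (k - l).
Proof.
case: e => [|[|//]] lohi _; first exact: partial_taylory0.
exact: partial_taylory1.
Qed.

(** Expand in [y] along the vertical line through [p], then expand each
    coefficient in [x] along the horizontal line through [m].  The powers of the
    distances that are lost by differentiating [e + l] times are given back by
    the factor [r ^+ (e + l)]. *)
Lemma partial_taylor2 (k e l : nat) (m p : R * R) (r rho : R) :
  xlo B0 < xhi B0 -> (e < 2)%N -> (e <= k)%N -> (l <= k)%N -> (k + k <= N)%N ->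
  box_set B0 m -> box_set B0 p ->
  `|p.1 - m.1| <= r -> `|p.2 - m.2| <= r -> r <= rho -> 1 <= rho ->
  r ^+ (e + l) * `|partial f e l p -
    dpoly2 k (fun a b => partial f a b m / (a`!)%:R / (b`!)%:R) e l
      (p.1 - m.1) (p.2 - m.2)| <= M * rho ^+ k * k.+1%:R * r ^+ k.
Proof.
case: m p => [mx my] [x y] /= lohi e2 ek lk kN hm hp ur vr rrho rho1.
have hq : box_set B0 (x, my) by case: hm hp => [_ ?] [? _].
have M0 : 0 <= M by apply: le_trans (hM (i := 0) (j := 0) (leq0n N) hm).
have r0 : 0 <= r by exact: le_trans ur.
have rho0 : 0 <= rho by exact: le_trans rho1.
have rX n : (n <= k)%N -> r ^+ n <= rho ^+ k.
  move=> nk; apply: (@le_trans _ _ (rho ^+ n)); first exact: lerXn2r.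
  exact: ler_weXn2l.
set u := x - mx; set v := y - my.
set c := fun a b => _.
pose D := dpoly k (fun b => partial f e b (x, my) / (b`!)%:R) l v.
rewrite -(subrK D (partial f e l (x, y))) -addrA.
apply: (le_trans (ler_wpM2l _ (ler_normD _ _))); first exact: exprn_ge0.
have -> : M * rho ^+ k * k.+1%:R * r ^+ k =
    M * rho ^+ k * r ^+ k + M * rho ^+ k * k%:R * r ^+ k.
  by rewrite -natr1; ring.
rewrite mulrDr; apply: lerD.
  apply: (@le_trans _ _ (r ^+ (e + l) * (M * r ^+ (k - l)))).
    rewrite ler_wpM2l ?exprn_ge0 //.
    have kN' : (e + k <= N)%N by apply: leq_trans kN; rewrite leq_add2r.
    apply: (le_trans (partial_taylory lohi e2 lk kN' hq hp)).
    by rewrite ler_wpM2l // lerXn2r ?nnegrE.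
  rewrite mulrCA -exprD -addnA subnKC // exprD mulrA ler_wpM2r ?exprn_ge0 //.
  by rewrite ler_wpM2l // rX.
rewrite dpoly2_yx /D dpolyB.
apply: (le_trans (ler_wpM2l _ (ler_norm_sum _ _ _))); first exact: exprn_ge0.
rewrite mulr_sumr.
have -> : M * rho ^+ k * k%:R * r ^+ k = \sum_(b < k) M * rho ^+ k * r ^+ k.
  by rewrite sumr_const card_ord -mulr_natr; ring.
apply: ler_sum => b _.
(* The coefficient of index b contributes at most M r^b r^k, and nothing at all
   for b < l. *)
have [bl|lb] := ltnP b l.
  rewrite ffact_small // mulr0 mul0r normr0 mulr0.
  by rewrite !mulr_ge0 ?exprn_ge0.
have kbN : (k + b <= N)%N by apply: leq_trans kN; rewrite leq_add2l ltnW.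
have -> : partial f e b (x, my) / b`!%:R - dpoly k (c^~ b) e u =
    (partial f e b (x, my) -
     dpoly k (fun a => partial f a b (mx, my) / (a`!)%:R) e u) / b`!%:R.
  rewrite mulrBl; congr (_ - _); rewrite /dpoly mulr_suml.
  by apply: eq_bigr => a _; rewrite /c; ring.
(* The weight of the coefficient of index b is 1 / (b - l)!. *)
have w1 : `|(b`!%:R)^-1 * (b ^_ l)%:R| <= 1 :> R.
  rewrite ger0_norm ?mulr_ge0 ?invr_ge0 ?ler0n // mulrC.
  rewrite ler_pdivrMr ?ltr0n ?fact_gt0 // mul1r ler_nat -(ffact_fact lb).
  by rewrite leq_pmulr // fact_gt0.
set T := _ - dpoly _ _ _ _.
have hT : `|T| <= M * r ^+ (k - e).
  apply: (le_trans (partial_taylorx ek kbN hm hq)).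
  by rewrite ler_wpM2l // lerXn2r ?nnegrE.
have hv : `|v ^+ (b - l)| <= r ^+ (b - l).
  by rewrite normrX lerXn2r ?nnegrE.
have E : r ^+ (e + l) * (M * r ^+ (k - e) * 1 * r ^+ (b - l)) =
    M * r ^+ b * r ^+ k.
  have -> : r ^+ k = r ^+ e * r ^+ (k - e) by rewrite -exprD subnKC.
  have -> : r ^+ b = r ^+ l * r ^+ (b - l) by rewrite -exprD subnKC.
  by rewrite exprD; ring.
apply: (@le_trans _ _ (M * r ^+ b * r ^+ k)); last first.
  by rewrite ler_wpM2r ?exprn_ge0 // ler_wpM2l // rX // ltnW.
rewrite -E ler_wpM2l ?exprn_ge0 // -(mulrA T) !normrM.
by rewrite -[`|_^-1| * _]normrM !ler_pM ?mulr_ge0 ?exprn_ge0.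
Qed.

End BoxTaylor.

(** * Hermite interpolation by cubic and bicubic polynomials *)
Lemma dpoly4_0 (R : realType) (c : nat -> R) (u : R) :
  dpoly 4 c 0 u =
  c 0%N + c 1%N * u + c 2%N * u ^+ 2 + c 3%N * u ^+ 3.
Proof.
rewrite /dpoly !big_ord_recl big_ord0 /= /bump /= !addn0 !add1n !ffactn0 !subn0.
by ring.
Qed.

Lemma dpoly4_1 (R : realType) (c : nat -> R) (u : R) :
  dpoly 4 c 1 u = c 1%N + 2 * c 2%N * u + 3 * c 3%N * u ^+ 2.
Proof.
rewrite /dpoly !big_ord_recl big_ord0 /= /bump /= !addn0 !add1n !ffactn1.
by rewrite !subn1 /=; ring.
Qed.

(** A cubic is recovered from its values [F0, F1] and its slopes [G0, G1]
    (multiplied by [r]) at [r] and [- r] by a formula that involves [r] only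
    through the scaling, so the constant [2] does not depend on [r].  It is
    attained by the coefficient of degree one. *)
Lemma hermite1_le (R : realType) (c : nat -> R) (r K : R) (a : nat) :
  0 < r -> (forall (s : bool) e, (e < 2)%N ->
    r ^+ e * `|dpoly 4 c e ((-1) ^+ s * r)| <= K) ->
  (a < 4)%N -> `|c a| * r ^+ a <= 2 * K.
Proof.
move=> r0 h a4.
have rX n : `|r ^+ n| = r ^+ n by rewrite ger0_norm // exprn_ge0 // ltW.
have hh (s : bool) e : (e < 2)%N ->
    `|r ^+ e * dpoly 4 c e ((-1) ^+ s * r)| <= K.
  by move=> e2; rewrite normrM rX h.
move: (hh false 0%N isT) (hh true 0%N isT) (hh false 1%N isT) (hh true 1%N isT).
rewrite !dpoly4_0 !dpoly4_1 /= -[r ^+ a]rX -normrM !ler_norml !expr0 !expr1.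
set F0 := 1 * _; set F1 := 1 * _; set G0 := r * _; set G1 := r * _.
move=> hF0 hF1 hG0 hG1.
have E0 : c 0%N * r ^+ 0 = (F0 + F1) / 2 - (G0 - G1) / 4.
  by rewrite /F0 /F1 /G0 /G1; field.
have E1 : c 1%N * r ^+ 1 = 3 / 4 * (F0 - F1) - (G0 + G1) / 4.
  by rewrite /F0 /F1 /G0 /G1; field.
have E2 : c 2%N * r ^+ 2 = (G0 - G1) / 4.
  by rewrite /F0 /F1 /G0 /G1; field.
have E3 : c 3%N * r ^+ 3 = (G0 + G1) / 4 - (F0 - F1) / 4.
  by rewrite /F0 /F1 /G0 /G1; field.
case: a a4 => [_|[_|[_|[_|//]]]]; rewrite ?E0 ?E1 ?E2 ?E3; lra.
Qed.

(** The even coefficients depend on the sum of the values and the difference of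
    the slopes, the odd ones on the difference of the values and the sum of the
    slopes. *)
Lemma hermite1_exists (R : realType) (r : R) (D : bool -> nat -> R) :
  r != 0 -> exists c : nat -> R, forall (s : bool) e, (e < 2)%N ->
    dpoly 4 c e ((-1) ^+ s * r) = D s e.
Proof.
move=> r0.
pose a2 := (D false 1%N - D true 1%N) / (4 * r).
pose a3 := ((D false 1%N + D true 1%N) / 2 -
  (D false 0%N - D true 0%N) / (2 * r)) / (2 * r ^+ 2).
exists (nth 0 [:: (D false 0%N + D true 0%N) / 2 - a2 * r ^+ 2;
  (D false 0%N - D true 0%N) / (2 * r) - a3 * r ^+ 2; a2; a3]).
move=> [] [|[|//]] _; rewrite ?dpoly4_0 ?dpoly4_1 /= ?expr0 ?expr1 /a2 /a3;
  by field.
Qed.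

(** Interpolation on a square is the tensor product of the interpolation in each
    variable, hence the constant is [2 * 2]: the bound in one variable is applied
    in [y] for fixed [s] and [e], then in [x] for fixed [b]. *)
Lemma hermite2_le (R : realType) (c : nat -> nat -> R) (r K : R) (a b : nat) :
  0 < r -> (forall (s t : bool) e l, (e < 2)%N -> (l < 2)%N ->
    r ^+ (e + l) * `|dpoly2 4 c e l ((-1) ^+ s * r) ((-1) ^+ t * r)| <= K) ->
  (a < 4)%N -> (b < 4)%N -> `|c a b| * r ^+ (a + b) <= 4 * K.
Proof.
move=> r0 h a4 b4.
have rX n : `|r ^+ n| = r ^+ n by rewrite ger0_norm // exprn_ge0 // ltW.
have dpolyZ (w : R) c' e u :
    dpoly 4 (fun i => w * c' i) e u = w * dpoly 4 c' e u.
  by rewrite /dpoly mulr_sumr; apply: eq_bigr => i _; rewrite !mulrA.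
have -> : `|c a b| * r ^+ (a + b) = `|r ^+ b * c a b| * r ^+ a.
  by rewrite normrM rX exprD; ring.
have -> : 4 * K = 2 * (2 * K) by ring.
apply: (@hermite1_le R (fun i => r ^+ b * c i b)) => // s e e2.
rewrite dpolyZ normrM rX mulrCA mulrC -[X in X * `|_|](rX e) -normrM.
apply: (@hermite1_le R (fun j => r ^+ e * dpoly 4 (c^~ j) e ((-1) ^+ s * r)))
  => // t l l2.
by rewrite dpolyZ -dpoly2_yx normrM rX mulrA -exprD addnC h.
Qed.

Lemma hermite2_exists (R : realType) (r : R)
    (D : bool -> bool -> nat -> nat -> R) :
  r != 0 -> exists c : nat -> nat -> R, forall (s t : bool) e l,
    (e < 2)%N -> (l < 2)%N ->
    dpoly2 4 c e l ((-1) ^+ s * r) ((-1) ^+ t * r) = D s t e l.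
Proof.
move=> r0.
have /choice[cy hcy] (se : bool * nat) :=
  hermite1_exists (fun t l => D se.1 t se.2 l) r0.
have /choice[cx hcx] (b : nat) := hermite1_exists (fun s e => cy (s, e) b) r0.
exists (fun a b => cx b a) => s t e l e2 l2.
rewrite dpoly2_yx -(hcy (s, e)) //; congr dpoly.
by apply/funext => b; rewrite hcx.
Qed.

(** Taylor expansion of [P] about [m], first in the outer variable [x] over the
    ring [{poly R}], then in [y] for each coefficient. *)
Lemma bicubic_dpoly2 (R : realType) (P : {poly {poly R}}) (m : R * R) :
  bicubic P -> exists c : nat -> nat -> R,
    poly_fun P = fun p => dpoly2 4 c 0 0 (p.1 - m.1) (p.2 - m.2).
Proof.
move=> [sX sY].
exists (fun a b => (P^`N(a).[m.1%:P])^`N(b).[m.2]).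
apply/funext => -[x y]; rewrite /poly_fun /=.
have -> : x%:P = m.1%:P + (x - m.1)%:P :> {poly R}.
  by rewrite -polyCD addrCA subrr addr0.
rewrite (nderiv_taylor_wide (mulrC _ _) sX) horner_sum.
apply: eq_bigr => a _; rewrite -polyC_exp hornerM hornerC.
have sa : (size P^`N(a).[m.1%:P] <= 4)%N.
  apply: (leq_trans (max_size_evalC _ _)); apply: leq_trans sY.
  apply/bigmax_leqP => i _; rewrite coef_nderivn -scaler_nat.
  exact: leq_trans (size_scale_leq _ _) (max_size_coefXY _ _).
have {1}-> : y = m.2 + (y - m.2) by rewrite addrCA subrr addr0.
rewrite (nderiv_taylor_wide (mulrC _ _) sa) mulr_suml.
by apply: eq_bigr => b _; rewrite !ffactn0 !subn0; ring.
Qed.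

Lemma dpoly2_bicubic (R : realType) (c : nat -> nat -> R) (m : R * R) :
  exists P : {poly {poly R}}, bicubic P /\
    poly_fun P = fun p => dpoly2 4 c 0 0 (p.1 - m.1) (p.2 - m.2).
Proof.
exists (\sum_(a < 4) \sum_(b < 4)
  (c a b *: ('X - m.2%:P) ^+ b)%:P * (('X - m.1%:P) ^+ a)^:P); split; last first.
  apply/funext => -[x y]; rewrite /poly_fun /= !horner_sum.
  apply: eq_bigr => a _; rewrite !horner_sum; apply: eq_bigr => b _.
  rewrite hornerM hornerC horner_map /= hornerM hornerC hornerZ !horner_exp.
  by rewrite !hornerXsubC !ffactn0 !subn0; ring.
split.
  apply: (leq_trans (size_sum _ _ _)); apply/bigmax_leqP => a _.
  apply: (leq_trans (size_sum _ _ _)); apply/bigmax_leqP => b _.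
  rewrite mul_polyC; apply: (leq_trans (size_scale_leq _ _)).
  by rewrite size_map_polyC size_exp_XsubC.
apply/bigmax_leqP => i _; rewrite coef_sum.
apply: (leq_trans (size_sum _ _ _)); apply/bigmax_leqP => a _; rewrite coef_sum.
apply: (leq_trans (size_sum _ _ _)); apply/bigmax_leqP => b _.
rewrite coefCM coef_map /= mulrC mul_polyC; apply: (leq_trans (size_scale_leq _ _)).
by apply: (leq_trans (size_scale_leq _ _)); rewrite size_exp_XsubC.
Qed.

(** * The Hermite interpolant on a square *)
Definition box_corner (R : realType) (B : box R) (s t : bool) : R * R :=
  ((box_midpoint B).1 + (-1) ^+ s * box_radius B,
   (box_midpoint B).2 + (-1) ^+ t * box_radius B).

Lemma box_cornerP (R : realType) (B : box R) (p : R * R) :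
  is_square B -> is_corner B p <-> exists s t, p = box_corner B s t.
Proof.
rewrite /is_square /is_corner /box_corner /box_midpoint /box_radius /box_rx /box_ry.
move=> sq; split=> [[hx hy]|[[] [[] ->]] /=]; last first.
- by split; [right|right]; lra.
- by split; [right|left]; lra.
- by split; [left|right]; lra.
- by split; [left|left]; lra.
exists `[<p.1 = xlo B>], `[<p.2 = ylo B>].
case: p hx hy => x y /= hx hy; congr pair.
  by case: asboolP => h /=; [|case: hx => // hx]; lra.
by case: asboolP => h /=; [|case: hy => // hy]; lra.
Qed.

Lemma box_corner_in (R : realType) (B : box R) (s t : bool) :
  is_square B -> box_set B (box_corner B s t).
Proof.
rewrite /is_square /box_corner /box_midpoint /box_radius /box_rx /box_ry => sq.
have := box_x B; have := box_y B.
by case: s; case: t; split; rewrite /= in_itv /=; lra.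
Qed.

Lemma box_midpoint_in (R : realType) (B : box R) : box_set B (box_midpoint B).
Proof.
have := box_x B; have := box_y B.
by split; rewrite /= in_itv /=; lra.
Qed.

Lemma box_dist_midpoint (R : realType) (B : box R) (p : R * R) :
  is_square B -> box_set B p ->
  `|p.1 - (box_midpoint B).1| <= box_radius B /\
  `|p.2 - (box_midpoint B).2| <= box_radius B.
Proof.
rewrite /is_square /box_set /box_midpoint /box_radius /box_rx /box_ry.
move=> sq [/=]; rewrite !in_itv /= !ler_norml => hx hy; lra.
Qed.

Lemma interpolates_dpoly2 (R : realType) (f : R * R -> R) (B : box R)
    (i j : nat) (c : nat -> nat -> R) :
  is_square B ->
  hermite_interpolates f B i j (fun p => dpoly2 4 c 0 0
    (p.1 - (box_midpoint B).1) (p.2 - (box_midpoint B).2)) <->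
  forall (s t : bool) e l, (e < 2)%N -> (l < 2)%N ->
    dpoly2 4 c e l ((-1) ^+ s * box_radius B) ((-1) ^+ t * box_radius B) =
    partial f (4 * i + e) (4 * j + l) (box_corner B s t).
Proof.
move=> sq; have sub (s t : bool) e l :
    dpoly2 4 c e l ((-1) ^+ s * box_radius B) ((-1) ^+ t * box_radius B) =
    dpoly2 4 c e l ((box_corner B s t).1 - (box_midpoint B).1)
      ((box_corner B s t).2 - (box_midpoint B).2).
  by congr dpoly2; rewrite /=; ring.
split=> [H s t e l e2 l2|H p /(box_cornerP _ sq)[s [t ->]]]; last first.
  by split; rewrite ?partial_dpoly2 -sub H // ?addn0.
have /H[] : is_corner B (box_corner B s t).
  by apply/(box_cornerP _ sq); exists s, t.
rewrite !partial_dpoly2 sub => h00 h10 h01 h11.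
by case: e l e2 l2 => [|[|//]] [|[|//]] _ _; rewrite ?addn0.
Qed.

(** The interpolation problem is solvable, so the polynomial chosen by
    [hermite_poly] does satisfy its specification.  Centring it at the midpoint
    makes its Taylor coefficients there the coefficients [c]. *)
Lemma hermite_dpoly2 (R : realType) (f : R * R -> R) (B : box R) (i j : nat) :
  is_square B -> 0 < box_radius B ->
  exists c : nat -> nat -> R,
    hermite f B i j = (fun p => dpoly2 4 c 0 0
      (p.1 - (box_midpoint B).1) (p.2 - (box_midpoint B).2)) /\
    forall (s t : bool) e l, (e < 2)%N -> (l < 2)%N ->
      dpoly2 4 c e l ((-1) ^+ s * box_radius B) ((-1) ^+ t * box_radius B) =
      partial f (4 * i + e) (4 * j + l) (box_corner B s t).
Proof.
move=> sq r0.
have [c0 hc0] := hermite2_exists (fun s t e l =>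
  partial f (4 * i + e) (4 * j + l) (box_corner B s t)) (lt0r_neq0 r0).
have [P [bP eP]] := dpoly2_bicubic c0 (box_midpoint B).
have exP : exists P : {poly {poly R}},
    bicubic P /\ hermite_interpolates f B i j (poly_fun P).
  by exists P; split=> //; rewrite eP; apply/interpolates_dpoly2.
have [bH iH] := xgetPex 0 exP.
have [c ec] := bicubic_dpoly2 (box_midpoint B) bH.
exists c; split; first exact: ec.
have {}iH : hermite_interpolates f B i j (poly_fun (hermite_poly f B i j)).
  exact: iH.
by rewrite ec in iH; apply/interpolates_dpoly2.
Qed.

Lemma dpoly2_at0 (R : realType) (d : nat) (c : nat -> nat -> R) (a b : nat) :
  (a < d)%N -> (b < d)%N -> dpoly2 d c a b 0 0 = c a b * (a`! * b`!)%:R.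
Proof.
by move=> ad bd; rewrite dpoly2_xy dpoly_at0 // dpoly_at0 // natrM; ring.
Qed.

(** Setting the coefficients of total degree above [3] to [0], instead of
    shortening the sums, keeps the Taylor polynomial and the remainder within the
    bicubic polynomials, where [dpoly2_le] applies to both. *)
Definition low_part (R : realType) (c : nat -> nat -> R) (a b : nat) : R :=
  if (a + b <= 3)%N then c a b else 0.

Lemma hermite_T_dpoly2 (R : realType) (f : R * R -> R) (B : box R) (i j : nat)
    (c : nat -> nat -> R) (p : R * R) :
  hermite f B i j = (fun p => dpoly2 4 c 0 0
    (p.1 - (box_midpoint B).1) (p.2 - (box_midpoint B).2)) ->
  hermite_T f B i j p = dpoly2 4 (low_part c) 0 0
    (p.1 - (box_midpoint B).1) (p.2 - (box_midpoint B).2).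
Proof.
rewrite /hermite_T /taylor => ->; rewrite big_mkord; apply: eq_bigr => a _.
rewrite big_mkord big_mkcond; apply: eq_bigr => b _.
rewrite /low_part; case: ifP => _; last by rewrite !mul0r.
rewrite partial_dpoly2 !subrr dpoly2_at0 // mulfK; last first.
  by rewrite pnatr_eq0 muln_eq0 !negb_or -!lt0n !fact_gt0.
by rewrite !ffactn0 !subn0 !mulr1.
Qed.

Lemma hermite_R_dpoly2 (R : realType) (f : R * R -> R) (B : box R) (i j : nat)
    (c : nat -> nat -> R) (p : R * R) :
  hermite f B i j = (fun p => dpoly2 4 c 0 0
    (p.1 - (box_midpoint B).1) (p.2 - (box_midpoint B).2)) ->
  hermite_R f B i j p = dpoly2 4 (fun a b => c a b - low_part c a b) 0 0
    (p.1 - (box_midpoint B).1) (p.2 - (box_midpoint B).2).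
Proof. by move=> h; rewrite /hermite_R (hermite_T_dpoly2 p h) h dpoly2B. Qed.

Lemma dpoly2_le (R : realType) (c : nat -> nat -> R) (u v r K : R) :
  `|u| <= r -> `|v| <= r ->
  (forall a b, (a < 4)%N -> (b < 4)%N -> `|c a b| * r ^+ (a + b) <= K) ->
  `|dpoly2 4 c 0 0 u v| <= 16 * K.
Proof.
move=> ur vr h.
have -> : 16 * K = \sum_(a < 4) \sum_(b < 4) K.
  by rewrite !sumr_const !card_ord -mulrnA mulr_natl.
apply: (le_trans (ler_norm_sum _ _ _)); apply: ler_sum => a _.
apply: (le_trans (ler_norm_sum _ _ _)); apply: ler_sum => b _.
apply: le_trans (h a b _ _) => //; rewrite !ffactn0 !subn0 !mulr1 !normrM.
have r0 : 0 <= r by exact: le_trans ur.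
rewrite exprD mulrA !normrX; apply: ler_pM; rewrite ?mulr_ge0 ?exprn_ge0 //.
  by apply: ler_pM; rewrite ?exprn_ge0 // lerXn2r.
by rewrite lerXn2r.
Qed.

(** * Exact ranges *)
Lemma range_on_le (R : realType) (g : R * R -> R) (B : box R) (K : R) :
  (forall p, box_set B p -> `|g p| <= K) ->
  `|ilo (range_on g B)| <= K /\ `|ihi (range_on g B)| <= K.
Proof.
move=> h; have hm := box_midpoint_in B.
have gm : (g @` box_set B) (g (box_midpoint B)) by exists (box_midpoint B).
have lb : lbound (g @` box_set B) (- K).
  by move=> _ [p hp <-]; have := h p hp; rewrite ler_norml => /andP[].
have ub : ubound (g @` box_set B) K.
  by move=> _ [p hp <-]; have := h p hp; rewrite ler_norml => /andP[].
have := h _ hm; rewrite /= !ler_norml => /andP[h1 h2].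
split; apply/andP; split.
- by apply: lb_le_inf => //; exists (g (box_midpoint B)).
- by apply: le_trans h2; apply: ge_inf => //; exists (- K).
- by apply: (le_trans h1); apply: ub_le_sup => //; exists K.
- by apply: ge_sup => //; exists (g (box_midpoint B)).
Qed.

(** Boundedness of [h], and hence of [g], guarantees that the infima and suprema
    over [B] are bounds and not default values. *)
Lemma range_on_dist (R : realType) (g h : R * R -> R) (B : box R) (K e : R) :
  (forall p, box_set B p -> `|h p| <= K) ->
  (forall p, box_set B p -> `|g p - h p| <= e) ->
  `|ilo (range_on g B) - ilo (range_on h B)| <= e /\
  `|ihi (range_on g B) - ihi (range_on h B)| <= e.
Proof.
move=> hK he.
have gK p : box_set B p -> `|g p| <= K + e.
  move=> hp; rewrite -(subrK (h p) (g p)) addrC (le_trans (ler_normD _ _)) //.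
  by rewrite lerD ?hK ?he.
have bnd (k : R * R -> R) L : (forall p, box_set B p -> `|k p| <= L) ->
    forall p, box_set B p -> ilo (range_on k B) <= k p <= ihi (range_on k B).
  move=> kL p hp; apply/andP; split.
    apply: ge_inf; last by exists p.
    by exists (- L) => _ [q hq <-]; have := kL q hq; rewrite ler_norml => /andP[].
  apply: ub_le_sup; last by exists p.
  by exists L => _ [q hq <-]; have := kL q hq; rewrite ler_norml => /andP[].
have ne (k : R * R -> R) : k @` box_set B !=set0.
  by exists (k (box_midpoint B)); exists (box_midpoint B) => //;
    exact: box_midpoint_in.
have {he}he p : box_set B p -> - e <= g p - h p <= e.
  by move=> hp; rewrite -ler_norml he.
rewrite !ler_norml; split; apply/andP; split.
- rewrite lerBrDr; apply: (lb_le_inf (ne g)) => _ [p hp <-].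
  by have := he p hp; have := bnd h K hK p hp; lra.
- suff : ilo (range_on g B) - e <= ilo (range_on h B) by lra.
  apply: (lb_le_inf (ne h)) => _ [p hp <-].
  by have := he p hp; have := bnd g _ gK p hp; lra.
- suff : ihi (range_on h B) <= ihi (range_on g B) + e by lra.
  apply: (ge_sup (ne h)) => _ [p hp <-].
  by have := he p hp; have := bnd g _ gK p hp; lra.
- rewrite lerBlDr; apply: (ge_sup (ne g)) => _ [p hp <-].
  by have := he p hp; have := bnd h K hK p hp; lra.
Qed.

Lemma itv_mag_add_le (R : realType) (I J : itv2 R) (K L : R) :
  itv_mag I <= K -> itv_mag J <= L -> itv_mag (itv_add I J) <= K + L.
Proof.
rewrite /itv_mag /= !ge_max => /andP[h1 h2] /andP[h3 h4].
by rewrite !(le_trans (ler_normD _ _)) ?lerD.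
Qed.

Lemma itv_mag_range_on (R : realType) (g : R * R -> R) (B : box R) (K : R) :
  (forall p, box_set B p -> `|g p| <= K) -> itv_mag (range_on g B) <= K.
Proof. by move=> /range_on_le[h1 h2]; rewrite ge_max h1. Qed.

(** * Bounds uniform over the squares in the box *)
Definition ubounded (R : realType) (P : box R -> Prop) (q : box R -> R) : Prop :=
  exists K : R, forall B, P B -> `|q B| <= K.

Lemma uboundedM (R : realType) (P : box R -> Prop) (q1 q2 : box R -> R) :
  ubounded P q1 -> ubounded P q2 -> ubounded P (fun B => q1 B * q2 B).
Proof.
move=> [K hK] [L hL]; exists (`|K| * `|L|) => B hB.
rewrite normrM ler_pM //.
  by rewrite (le_trans (hK B hB)) // ler_norm.
by rewrite (le_trans (hL B hB)) // ler_norm.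
Qed.

Lemma ubounded_cst (R : realType) (P : box R -> Prop) (x : R) :
  ubounded P (fun=> x).
Proof. by exists `|x|. Qed.

Lemma uboundedX (R : realType) (P : box R -> Prop) (q : box R -> R) (n : nat) :
  ubounded P q -> ubounded P (fun B => q B ^+ n).
Proof.
move=> hq; elim: n => [|n IH]; first exact: ubounded_cst.
have [K hK] := uboundedM hq IH.
by exists K => B hB; rewrite exprS hK.
Qed.

Lemma ubounded_sum (R : realType) (P : box R -> Prop) (a b : nat)
    (q : nat -> box R -> R) :
  (forall k, (a <= k < b)%N -> ubounded P (q k)) ->
  ubounded P (fun B => \sum_(a <= k < b) q k B).
Proof.
move=> h.
have /choice[K hK] (k : nat) : exists K : R, (a <= k < b)%N ->
    forall B, P B -> `|q k B| <= K.
  by have [/h[K hK]|_] := boolP (a <= k < b)%N; [exists K | exists 0].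
exists (\sum_(a <= k < b) K k) => B hB.
apply: (le_trans (ler_norm_sum _ _ _)).
rewrite big_nat [leRHS]big_nat; apply: ler_sum => k hk.
exact: hK.
Qed.

(** * Quartic convergence *)
Section Convergence.
Context (R : realType) (f : R * R -> R) (n : nat) (B0 : box R) (M rho : R).
Hypothesis hf : bounded_partials_upto f (4 * n + 4) B0.
Hypothesis M0 : 0 <= M.
Hypothesis hM : forall i j p, (i + j <= 4 * n + 4)%N -> box_set B0 p ->
  `|partial f i j p| <= M.
Hypothesis rho1 : 1 <= rho.
Hypothesis hrho : box_rx B0 <= rho.

Definition small_square (B : box R) : Prop :=
  [/\ is_square B, 0 < box_radius B & box_set B `<=` box_set B0].

Lemma subbox_x (B : box R) : box_set B `<=` box_set B0 ->
  xlo B0 <= xlo B /\ xhi B <= xhi B0.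
Proof.
move=> sub; have hx := box_x B; have hy := box_y B.
have /sub[/=] : box_set B (xlo B, ylo B).
  by split; rewrite /= in_itv /= lexx ?hx ?hy.
have /sub[/=] : box_set B (xhi B, yhi B).
  by split; rewrite /= in_itv /= lexx ?hx ?hy.
by rewrite !in_itv /= => /andP[_ ->] _ /andP[-> _] _.
Qed.

Lemma radius_le (B : box R) : small_square B -> box_radius B <= rho.
Proof.
case=> _ _ /subbox_x[h1 h2]; apply: le_trans hrho.
by rewrite /box_radius /box_rx; lra.
Qed.

Lemma radiusX_le (B : box R) (k d : nat) : small_square B -> (k <= d)%N ->
  box_radius B ^+ k <= rho ^+ d.
Proof.
move=> hB kd; have [_ r0 _] := hB; have r0' := ltW r0.
have rho0 : 0 <= rho by exact: le_trans rho1.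
apply: (@le_trans _ _ (rho ^+ k)); last exact: ler_weXn2l.
by rewrite lerXn2r ?nnegrE // radius_le.
Qed.

(** The restriction on [i + j] keeps the order of the interpolated derivatives
    below [4 * n]; the factor [rho ^+ 2] bounds the scaling [r ^+ (e + l)]. *)
Lemma hermite_data_le (B : box R) (i j : nat) (c : nat -> nat -> R) :
  (i + j < n)%N -> small_square B ->
  (forall (s t : bool) e l, (e < 2)%N -> (l < 2)%N ->
    dpoly2 4 c e l ((-1) ^+ s * box_radius B) ((-1) ^+ t * box_radius B) =
    partial f (4 * i + e) (4 * j + l) (box_corner B s t)) ->
  forall a b, (a < 4)%N -> (b < 4)%N ->
    `|c a b| * box_radius B ^+ (a + b) <= 4 * (rho ^+ 2 * M).
Proof.
move=> ijn hB hc a b a4 b4; have [sq r0 sub] := hB.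
apply: hermite2_le => // s t e l e2 l2; rewrite hc //.
apply: ler_pM; rewrite ?exprn_ge0 ?(ltW r0) //.
  by apply: radiusX_le => //; case: e e2 l l2 => [|[|//]] _ [|[|//]].
apply: hM; last by apply: sub; exact: box_corner_in.
by move: ijn e2 l2; lia.
Qed.

Lemma hermite_TR_ranges_le (B : box R) (i j : nat) :
  (i + j < n)%N -> small_square B ->
  let K := 16 * (4 * (rho ^+ 2 * M)) in
  (forall p, box_set B p -> `|hermite_T f B i j p| <= K) /\
  (forall p, box_set B p -> `|hermite_R f B i j p| <= K).
Proof.
move=> ijn hB K; have [sq r0 sub] := hB.
have [c [hH hc]] := hermite_dpoly2 f i j sq r0.
have bc := hermite_data_le ijn hB hc.
have K0 : 0 <= 4 * (rho ^+ 2 * M).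
  by rewrite mulr_ge0 // mulr_ge0 // exprn_ge0 // (le_trans _ rho1).
split=> p hp; have [u v] := box_dist_midpoint sq hp.
  rewrite (hermite_T_dpoly2 p hH); apply: (dpoly2_le u v) => a b a4 b4.
  by rewrite /low_part; case: ifP; rewrite ?normr0 ?mul0r // bc.
rewrite (hermite_R_dpoly2 p hH); apply: (dpoly2_le u v) => a b a4 b4.
by rewrite /low_part; case: ifP; rewrite ?subrr ?subr0 ?normr0 ?mul0r // bc.
Qed.

Lemma hermite_TR_ubounded (i j : nat) : (i + j < n)%N ->
  ubounded small_square (fun B => itv_mag (hermite_TR f B i j)).
Proof.
pose K := 16 * (4 * (rho ^+ 2 * M)).
move=> ijn; exists (K + K) => B hB.
have [hT hR] := hermite_TR_ranges_le ijn hB.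
rewrite ger0_norm; last by rewrite /itv_mag le_max normr_ge0.
by apply: itv_mag_add_le; exact: itv_mag_range_on.
Qed.

(** With [c0] the Taylor coefficients of [f] at the midpoint, [E] bounds the
    scaled Hermite data of the error of the Taylor polynomial.  Then
    [|c - c0| <= 4 E] in scaled form, and [|c0| <= E] in total degree at least
    [4], so the coefficients of the remainder [R] are at most [5 E].  A bicubic
    polynomial has [16] of them: [80 = 16 * 5], and
    [145 = 1 + 16 * 4 + 80] comes from [f - T = (f - S) - (H - S) + R], where
    [S] is the polynomial with coefficients [c0]. *)
Lemma hermite_approx (B : box R) : (1 <= n)%N -> small_square B ->
  let E := M * rho ^+ 4 * 5 * box_radius B ^+ 4 in
  (forall p, box_set B p -> `|f p - hermite_T f B 0 0 p| <= 145 * E) /\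
  (forall p, box_set B p -> `|hermite_R f B 0 0 p| <= 80 * E).
Proof.
move=> hn hB; have [sq r0 sub] := hB; move=> E.
set m := box_midpoint B; set r := box_radius B in r0 E *.
have hm : box_set B0 m by apply: sub; exact: box_midpoint_in.
have rho0 : 0 <= rho by exact: le_trans rho1.
have E0 : 0 <= E.
  by rewrite mulr_ge0 ?exprn_ge0 ?(ltW r0) // mulr_ge0 // mulr_ge0 // exprn_ge0.
have lohi : xlo B0 < xhi B0.
  by have [h1 h2] := subbox_x sub; move: r0; rewrite /r /box_radius /box_rx; lra.
have [c [hH hc]] := hermite_dpoly2 f 0 0 sq r0.
pose c0 a b := partial f a b m / (a`!)%:R / (b`!)%:R.
have taylorE p e l : box_set B p -> (e < 2)%N -> (l < 2)%N ->
    r ^+ (e + l) * `|partial f e l p -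
      dpoly2 4 c0 e l (p.1 - m.1) (p.2 - m.2)| <= E.
  move=> hp e2 l2; have [u v] := box_dist_midpoint sq hp.
  apply: (partial_taylor2 hf hM lohi) => //.
  - by move: e2; lia.
  - by move: l2; lia.
  - by move: hn; lia.
  - exact: sub.
  - exact: radius_le.
have cc0 a b : (a < 4)%N -> (b < 4)%N ->
    `|c a b - c0 a b| * r ^+ (a + b) <= 4 * E.
  apply: (hermite2_le (c := fun a b => c a b - c0 a b)) => // s t e l e2 l2.
  rewrite -dpoly2B hc // !muln0 !add0n.
  have -> : (-1) ^+ s * r = (box_corner B s t).1 - m.1.
    by rewrite /m /r /=; ring.
  have -> : (-1) ^+ t * r = (box_corner B s t).2 - m.2.
    by rewrite /m /r /=; ring.
  by apply: taylorE => //; exact: box_corner_in.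
have c0_high a b : (a < 4)%N -> (b < 4)%N -> ~~ (a + b <= 3)%N ->
    `|c0 a b| * r ^+ (a + b) <= E.
  move=> a4 b4; rewrite -ltnNge => ab.
  rewrite -(subnK ab) exprD mulrA /E ler_wpM2r ?exprn_ge0 ?(ltW r0) //.
  apply: (@le_trans _ _ (M * rho ^+ 4)); last first.
    by rewrite ler_peMr ?mulr_ge0 ?exprn_ge0 // ler1n.
  have c0M : `|c0 a b| <= M.
    have fact_inv k : `|(k`!%:R)^-1| <= 1 :> R.
      by rewrite ger0_norm ?invr_ge0 // invf_le1 ?ltr0n ?fact_gt0 // ler1n fact_gt0.
    have abN : (a + b <= 4 * n + 4)%N by move: a4 b4 hn; lia.
    rewrite /c0 !normrM -mulrA -[leRHS]mulr1; apply: ler_pM; rewrite ?mulr_ge0 //.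
      exact: hM.
    by rewrite -[leRHS]mulr1; apply: ler_pM; rewrite ?fact_inv.
  apply: ler_pM => //; first by rewrite exprn_ge0 ?(ltW r0).
  by apply: radiusX_le => //; move: a4 b4; lia.
have c_high a b : (a < 4)%N -> (b < 4)%N ->
    `|c a b - low_part c a b| * r ^+ (a + b) <= 5 * E.
  move=> a4 b4; rewrite /low_part; case: ifP => [_|/negbT ab].
    by rewrite subrr normr0 mul0r mulr_ge0.
  have -> : c a b - 0 = (c a b - c0 a b) + c0 a b by ring.
  have -> : 5 * E = 4 * E + E by ring.
  apply: (@le_trans _ _ ((`|c a b - c0 a b| + `|c0 a b|) * r ^+ (a + b))).
    by rewrite ler_wpM2r ?ler_normD // exprn_ge0 // ltW.
  by rewrite mulrDl lerD // ?cc0 ?c0_high.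
have hR p : box_set B p -> `|hermite_R f B 0 0 p| <= 80 * E.
  move=> hp; have [u v] := box_dist_midpoint sq hp.
  rewrite (hermite_R_dpoly2 p hH); have -> : 80 * E = 16 * (5 * E) by ring.
  exact: (dpoly2_le u v).
split=> // p hp; have [u v] := box_dist_midpoint sq hp.
have h1 : `|f p - dpoly2 4 c0 0 0 (p.1 - m.1) (p.2 - m.2)| <= E.
  have := taylorE p 0%N 0%N hp isT isT.
  by rewrite expr0 mul1r; case: (p).
have h2 : `|dpoly2 4 c 0 0 (p.1 - m.1) (p.2 - m.2) -
    dpoly2 4 c0 0 0 (p.1 - m.1) (p.2 - m.2)| <= 64 * E.
  rewrite dpoly2B; have -> : 64 * E = 16 * (4 * E) by ring.
  exact: (dpoly2_le u v).
have h3 := hR p hp.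
have eH : hermite f B 0 0 p = dpoly2 4 c 0 0 (p.1 - m.1) (p.2 - m.2).
  by rewrite hH.
move: h3; rewrite /hermite_R eH; move: h1 h2.
rewrite !ler_norml; lra.
Qed.

(** Taking one factor [Omega_H] out of each term leaves a finite sum of products
    of uniformly bounded quantities. *)
Lemma hermite_V_le (F : nat -> nat -> box R -> itv2 R) :
  (forall i j, (i + j = n \/ i + j = n.+1)%N ->
    range_function_bounded B0 (F i j)) ->
  exists K : R, forall B, small_square B ->
    `|hermite_V f F n B| <= K * box_radius B ^+ 4.
Proof.
move=> hF.
have mag0 (I : itv2 R) : `|itv_mag I| = itv_mag I.
  by rewrite ger0_norm // /itv_mag le_max normr_ge0.
have bF i j : (i + j = n \/ i + j = n.+1)%N ->
    ubounded small_square (fun B => itv_mag (F i j B)).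
  move=> /hF[K hK]; exists K => B [_ _ sub]; rewrite mag0.
  exact: hK.
have bv k : (1 <= k < n.+2)%N ->
    ubounded small_square (fun B => hermite_v f F n B k).
  move=> /andP[k1 kn]; rewrite /hermite_v; have [kltn|nk] := ltnP k n.
    apply: ubounded_sum => j /andP[_ jk]; apply: uboundedM;
      first exact: ubounded_cst.
    by apply: hermite_TR_ubounded; rewrite subnK.
  have [_|kNn] := eqVneq k n.
    apply: ubounded_sum => j /andP[_ jn]; apply: uboundedM;
      first exact: ubounded_cst.
    by apply: bF; left; rewrite subnK.
  apply: ubounded_sum => j /andP[_ jn]; apply: uboundedM;
      first exact: ubounded_cst.
  by apply: bF; right; rewrite subnK // ltnW.
have br : ubounded small_square (@box_radius R).
  by exists rho => B hB; have [_ r0 _] := hB; rewrite gtr0_norm // radius_le.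
have bO : ubounded small_square (@Omega_H R).
  by apply: uboundedM; [exact: ubounded_cst | exact: uboundedX].
have [K hK] : ubounded small_square (fun B =>
    \sum_(1 <= k < n.+2) hermite_v f F n B k * (Omega_H B ^+ k.-1 * 24^-1)).
  apply: ubounded_sum => k hk; apply: uboundedM; first exact: bv.
  by apply: uboundedM; [exact: uboundedX | exact: ubounded_cst].
exists K => B hB; have [_ r0 _] := hB.
have -> : hermite_V f F n B = (\sum_(1 <= k < n.+2)
    hermite_v f F n B k * (Omega_H B ^+ k.-1 * 24^-1)) * box_radius B ^+ 4.
  rewrite /hermite_V mulr_suml !big_nat; apply: eq_bigr => k /andP[k1 _].
  have -> : Omega_H B ^+ k = Omega_H B ^+ k.-1 * (24^-1 * box_radius B ^+ 4).
    by rewrite -{1}(prednK k1) exprSr.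
  by rewrite !mulrA.
rewrite normrM [X in _ * X]ger0_norm ?exprn_ge0 ?(ltW r0) //.
by rewrite ler_wpM2r ?hK // exprn_ge0 // ltW.
Qed.

End Convergence.

Theorem theorem5 (R : realType) (n : nat) (hn : (1 <= n)%N) (B0 : box R)
    (f : R * R -> R)
    (hf : bounded_partials_upto f (4 * n + 4) B0)
    (F : nat -> nat -> box R -> itv2 R)
    (hF : forall i j : nat, (i + j = n \/ i + j = n.+1)%N ->
       is_range_function [set p | ex_partial f (4 * i) (4 * j) p]
         (partial f (4 * i) (4 * j)) (F i j) /\
       range_function_bounded B0 (F i j)) :
  exists C : R, 0 < C /\
    forall B : box R, is_square B -> 0 < box_radius B ->
      box_set B `<=` box_set B0 ->
      itv_hausdorff (range_on f B) (hermite_form f F n B) <= C * box_width B ^+ 4.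
Proof.
have [M [M0 hM]] := partials_common_bound hf.
pose rho := 1 + box_rx B0.
have rx0 : 0 <= box_rx B0 by have := box_x B0; rewrite /box_rx; lra.
have rho1 : 1 <= rho by rewrite /rho; lra.
have hrho : box_rx B0 <= rho by rewrite /rho; lra.
have [|K hK] := @hermite_V_le R f n B0 M rho M0 hM rho1 hrho F.
  by move=> i j /hF[].
(* The endpoints of the ranges of f and T differ by at most 145 L r^4, those of
   R are at most 80 L r^4. *)
pose L := M * rho ^+ 4 * 5.
have L0 : 0 <= L.
  by rewrite mulr_ge0 // mulr_ge0 // exprn_ge0 // (le_trans _ rho1).
(* The summand 1 only ensures that the constant is positive. *)
exists (225 * L + `|K| + 1); split; first by have := normr_ge0 K; lra.
move=> B sq r0 sub; have hB : small_square B0 B by [].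
have [hT hR] := hermite_approx hf M0 hM rho1 hrho hn hB.
have [bT _] := hermite_TR_ranges_le M0 hM rho1 hrho (i := 0) (j := 0) hn hB.
have [dlo dhi] := range_on_dist bT hT; have [Rlo Rhi] := range_on_le hR.
have hV : `|hermite_V f F n B| <= `|K| * box_radius B ^+ 4.
  by rewrite (le_trans (hK B hB)) // ler_wpM2r ?ler_norm // exprn_ge0 // ltW.
rewrite -/L in dlo dhi Rlo Rhi.
have r4 : 0 <= box_radius B ^+ 4 by rewrite exprn_ge0 // ltW.
have wr : box_radius B ^+ 4 <= box_width B ^+ 4.
  rewrite lerXn2r ?nnegrE ?(ltW r0) // /box_width -sq maxxx -/(box_radius B);
    lra.
apply: (@le_trans _ _ ((225 * L + `|K| + 1) * box_radius B ^+ 4)); last first.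
  by rewrite ler_wpM2l //; have := normr_ge0 K; lra.
have -> : (225 * L + `|K| + 1) * box_radius B ^+ 4 =
    225 * (L * box_radius B ^+ 4) + `|K| * box_radius B ^+ 4 + box_radius B ^+ 4.
  by ring.
move: dlo dhi Rlo Rhi hV r4; rewrite /itv_hausdorff ge_max /=.
rewrite !ler_norml => /andP[? ?] /andP[? ?] /andP[? ?] /andP[? ?] /andP[? ?] ?.
by apply/andP; split; apply/andP; split; lra.
Qed.
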